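(* Let $\Bbbk$ be a field of characteristic zero and let $\mathfrak V\subseteq\mathrm{di}\text{-}\mathrm{Alg}_0$ be a variety. Let $\widehat{\mathfrak V}\subseteq\mathrm{Alg}$ be the variety generated by all algebras $Z\boxtimes A$ with $Z\in\mathrm{pre}\text{-}\mathrm{Com}$ and $A\in\mathfrak V$. Then $\widehat{\mathfrak V}$ is the least of all varieties $\mathfrak M\subseteq\mathrm{Alg}$ such that $\mathfrak V\subseteq\mathrm{di}\text{-}\mathfrak M$; that is, $\mathfrak V\subseteq\mathrm{di}\text{-}\widehat{\mathfrak V}$, and $\widehat{\mathfrak V}\subseteq\mathfrak M$ for every variety $\mathfrak M\subseteq\mathrm{Alg}$ with $\mathfrak V\subseteq\mathrm{di}\text{-}\mathfrak M$.
   Context: $\Bbbk$ is a field of characteristic zero and $\Omega$ is a fixed index set. $\mathrm{Alg}$ is the variety of all linear spaces over $\Bbbk$ with bilinear operations $\circ_\omega$, $\omega\in\Omega$ (no identities imposed). $\mathrm{di}\text{-}\mathrm{Alg}_0$ is the variety of all linear spaces over $\Bbbk$ with bilinear operations $\vdash_\omega,\dashv_\omega$, $\omega\in\Omega$, satisfying $(x\vdash_\omega y-x\dashv_\omega y)\vdash_\mu z=0$ and $x\dashv_\mu(y\vdash_\omega z-y\dashv_\omega z)=0$ for all $\omega,\mu\in\Omega$. $\mathrm{Perm}$ is the variety of associative algebras over $\Bbbk$ satisfying $(xy-yx)z=0$. For $P\in\mathrm{Perm}$ and $A\in\mathrm{Alg}$, the space $P\otimes A$ carries the operations $$(p\otimes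 a)\vdash_\omega(q\otimes b)=pq\otimes(a\circ_\omega b),\qquad (p\otimes a)\dashv_\omega(q\otimes b)=qp\otimes(a\circ_\omega b).$$ For a variety $\mathfrak M\subseteq\mathrm{Alg}$, $\mathrm{di}\text{-}\mathfrak M$ is the variety (with operations $\vdash_\omega,\dashv_\omega$) generated by all $P\otimes A$ with $P\in\mathrm{Perm}$, $A\in\mathfrak M$. $\mathrm{pre}\text{-}\mathrm{Com}$ is the variety of algebras over $\Bbbk$ with one bilinear product satisfying $(xy+yx)z=x(yz)$. For $Z\in\mathrm{pre}\text{-}\mathrm{Com}$ and an algebra $A$ with operations $\vdash_\omega,\dashv_\omega$, $Z\boxtimes A$ is the space $Z\otimes A$ with operations $$(z\otimes a)\circ_\omega(w\otimes b)=zw\otimes(a\vdash_\omega b)+wz\otimes(a\dashv_\omega b).$$ *)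

(* Defs.v *)
From HB Require Import structures.
From mathcomp Require Import all_boot all_order all_algebra.

Set Implicit Arguments.
Unset Strict Implicit.
Unset Printing Implicit Defensive.

Import GRing.Theory.
Local Open Scope ring_scope.

Record alg (k : fieldType) (I : Type) := Alg {
  carrier :> lmodType k;
  op : I -> {bilinear carrier -> carrier -> carrier}
}.
Arguments op {k I} A i : rename.

(* Polynomials of the free algebra in countably many variables, written as
   formal expressions; distinct expressions may denote the same polynomial. *)
Inductive poly_expr (k : fieldType) (I : Type) : Type :=
| Var of nat
| Zero
| Add of poly_expr k I & poly_expr k I
| Scale of k & poly_expr k I
| Op of I & poly_expr k I & poly_expr k I.

Fixpoint eval (k : fieldType) (I : Type) (A : alg k I) (v : nat -> A)
    (f : poly_expr k I) : A :=
  match f with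
  | Var n => v n
  | Zero => 0
  | Add g h => eval v g + eval v h
  | Scale c g => c *: eval v g
  | Op i g h => op A i (eval v g) (eval v h)
  end.

Definition holds_in (k : fieldType) (I : Type) (f : poly_expr k I)
    (A : alg k I) : Prop :=
  forall v : nat -> A, eval v f = 0.

Definition alg_class (k : fieldType) (I : Type) := alg k I -> Prop.

Definition subclass (k : fieldType) (I : Type) (C D : alg_class k I) : Prop :=
  forall A, C A -> D A.

Definition is_variety (k : fieldType) (I : Type) (C : alg_class k I) : Prop :=
  exists E : poly_expr k I -> Prop,
    forall A, C A <-> (forall f, E f -> holds_in f A).

Definition generated_variety (k : fieldType) (I : Type) (C : alg_class k I) :
    alg_class k I :=
  fun A => forall V, is_variety V -> subclass C V -> V A.

(* The universal property determines (T, t) up to a unique isomorphism; the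
   classes below are classes of all algebras isomorphic to a tensor product. *)
Definition is_tensor_product (k : fieldType) (U V T : lmodType k)
    (t : {bilinear U -> V -> T}) : Prop :=
  forall (W : lmodType k) (b : {bilinear U -> V -> W}),
    exists f : {linear T -> W},
      (forall u v, f (t u v) = b u v) /\
      (forall g : {linear T -> W}, (forall u v, g (t u v) = b u v) -> g =1 f).

Inductive di_op (Omega : Type) : Type :=
| Vdash of Omega
| Dashv of Omega.

Definition mul (k : fieldType) (A : alg k unit) (x y : A) : A := op A tt x y.
Definition vdash (k : fieldType) (Omega : Type) (A : alg k (di_op Omega))
  (w : Omega) (x y : A) : A := op A (Vdash w) x y.
Definition dashv (k : fieldType) (Omega : Type) (A : alg k (di_op Omega))
  (w : Omega) (x y : A) : A := op A (Dashv w) x y.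

Definition diAlg0 (k : fieldType) (Omega : Type) : alg_class k (di_op Omega) :=
  fun A => forall (w m : Omega) (x y z : A),
    vdash m (vdash w x y - dashv w x y) z = 0 /\
    dashv m x (vdash w y z - dashv w y z) = 0.

Definition Perm (k : fieldType) : alg_class k unit :=
  fun P => forall x y z : P,
    mul (mul x y) z = mul x (mul y z) /\ mul (mul x y - mul y x) z = 0.

Definition preCom (k : fieldType) : alg_class k unit :=
  fun Z => forall x y z : Z, mul (mul x y + mul y x) z = mul x (mul y z).

Definition is_perm_tensor (k : fieldType) (Omega : Type) (P : alg k unit)
    (A : alg k Omega) (B : alg k (di_op Omega)) : Prop :=
  exists t : {bilinear P -> A -> B},
    is_tensor_product t /\
    forall (w : Omega) (p q : P) (a b : A),
      vdash w (t p a) (t q b) = t (mul p q) (op A w a b) /\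
      dashv w (t p a) (t q b) = t (mul q p) (op A w a b).

Definition is_box_tensor (k : fieldType) (Omega : Type) (Z : alg k unit)
    (A : alg k (di_op Omega)) (B : alg k Omega) : Prop :=
  exists t : {bilinear Z -> A -> B},
    is_tensor_product t /\
    forall (w : Omega) (z1 z2 : Z) (a b : A),
      op B w (t z1 a) (t z2 b) =
        t (mul z1 z2) (vdash w a b) + t (mul z2 z1) (dashv w a b).

Definition di (k : fieldType) (Omega : Type) (M : alg_class k Omega) :
    alg_class k (di_op Omega) :=
  generated_variety (fun B => exists (P : alg k unit) (A : alg k Omega),
    [/\ Perm P, M A & is_perm_tensor P A B]).

Definition hat (k : fieldType) (Omega : Type)
    (V : alg_class k (di_op Omega)) : alg_class k Omega :=
  generated_variety (fun B =>
    exists (Z : alg k unit) (A : alg k (di_op Omega)),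
      [/\ preCom Z, V A & is_box_tensor Z A B]).

(* Main.v *)
Require Import Defs.
From HB Require Import structures.
From mathcomp Require Import all_boot all_order all_algebra.
From mathcomp Require Import boolp functions.

(* Minimality. Suppose V is contained in di-M and f is an identity of M. The
   derivative of f, in which each perturbed occurrence of a variable becomes the
   centre of its dialgebra monomial, is an identity of every P (x) B with B in M,
   hence of V. In a pre-commutative algebra left multiplications commute, so the
   value of f in Z [x] A at sums of pure tensors is
   sum z_{i_1}(z_{i_2}(... z_j)) (x) u, where the coefficients u are those of this
   derivative at A. As k is infinite they cancel in each multidegree, so f holds
   in Z [x] A.

   V is contained in di-hat V. Let Z be the span of x, x^2, ... with product
   p.q = \int p q', enlarged by an element y with p.y = p(1) y and y.p = y.y = 0, and
   let P = k e1 + k e2 with p q = p_1 q. For A in V consider the elements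
   e1 (x) x (x) a + e2 (x) y (x) a of P (x) (Z [x] A). The e2-component of a
   polynomial f at these elements is y (x) f(a), because the e1-component, at
   x = 1, differs from f(a) by an element acting as zero in every non-central
   position. Hence every identity of P (x) (Z [x] A) holds in A. *)

Set Implicit Arguments.
Unset Strict Implicit.
Unset Printing Implicit Defensive.

Import Defs GRing.Theory.
Local Open Scope ring_scope.

(** * Polynomial identities with module coefficients *)

Lemma sum_by_value (I R : eqType) (M : nmodType) (l : seq I) (r : I -> R)
    (rs : seq R) (F : I -> M) :
  uniq rs -> {in l, forall i, r i \in rs} ->
  \sum_(i <- l) F i = \sum_(j <- rs) \sum_(i <- l | r i == j) F i.
Proof.
move=> rs_uniq r_rs.
under [RHS]eq_bigr => j _ do rewrite big_mkcond.
rewrite exchange_big /=; apply: eq_big_seq => i /r_rs ri.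
rewrite (bigD1_seq (r i)) //= eqxx big1 ?addr0 // => j.
by rewrite eq_sym => /negPf->.
Qed.

(** Sampling at [0, ..., N - 1], which are distinct in characteristic zero, gives an invertible
    Vandermonde system for the [U e]. *)
Lemma polynomial_function_coef0 (k : fieldType) (A : lmodType k) (N : nat)
    (U : nat -> A) :
  [pchar k] =i pred0 ->
  (forall x : k, \sum_(e < N) x ^+ e *: U e = 0) ->
  forall e, (e < N)%N -> U e = 0.
Proof.
move=> char0 U0 e ltN; pose e' := Ordinal ltN.
pose a := \row_(j < N) (j%:R : k).
pose V := Vandermonde N a.
have V_unit : V \in unitmx.
  rewrite unitmxE unitfE det_Vandermonde.
  apply/prodf_neq0 => i _; apply/prodf_neq0 => j ij.
  rewrite !mxE -natrB ?(ltnW ij) //.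
  by move/pcharf0P: char0 => ->; rewrite subn_eq0 -ltnNge.
have /matrixP VV := mulmxV V_unit.
have: \sum_(j < N) invmx V j e' *: (\sum_(i < N) (j%:R) ^+ i *: U i) = 0.
  by apply: big1 => j _; rewrite U0 scaler0.
under eq_bigr => j _ do rewrite scaler_sumr.
rewrite exchange_big /=.
under eq_bigr => i _ do
  [under eq_bigr => j _ do rewrite scalerA; rewrite -scaler_suml].
have VE (i : 'I_N) : \sum_(j < N) invmx V j e' * j%:R ^+ i = (i == e')%:R.
  have := VV i e'; rewrite !mxE => <-.
  by apply: eq_bigr => j _; rewrite !mxE mulrC.
under eq_bigr => i _ do rewrite VE.
rewrite (bigD1 e') //= eqxx scale1r big1 ?addr0 // => i /negPf->.
by rewrite scale0r.
Qed.

Definition mon (k : fieldType) (J : Type) (sigma : J -> k) (s : seq J) : k :=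
  \prod_(j <- s) sigma j.

Lemma mon_cat (k : fieldType) (J : Type) (sigma : J -> k) (s s' : seq J) :
  mon sigma (s ++ s') = mon sigma s * mon sigma s'.
Proof. by rewrite /mon big_cat. Qed.

(** When [sigma] varies at [j] alone, the sum is a polynomial function of [sigma j]; its
    coefficients are the components by number of occurrences of [j]. *)
Lemma sum_mon_count0 (k : fieldType) (J : eqType) (A : lmodType k)
    (l : seq (seq J * A)) (j : J) (c : nat) :
  [pchar k] =i pred0 ->
  (forall sigma : J -> k, \sum_(e <- l) mon sigma e.1 *: e.2 = 0) ->
  forall sigma : J -> k,
    \sum_(e <- l | count_mem j e.1 == c) mon sigma e.1 *: e.2 = 0.
Proof.
move=> char0 l0 sigma.
pose rest s := \prod_(i <- s | i != j) sigma i.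
have monE (sigma' : J -> k) s : (forall i, i != j -> sigma' i = sigma i) ->
    mon sigma' s = sigma' j ^+ count_mem j s * rest s.
  move=> eq_sigma; rewrite /mon (bigID (pred1 j)) /=; congr (_ * _).
    rewrite (eq_bigr (fun=> sigma' j)) => [|i /eqP-> //].
    by rewrite big_const_seq iter_mulr_1.
  exact: eq_bigr.
(* The bound includes [c], so that [c] is an admissible exponent even if no word attains it. *)
pose N := (maxn c (\max_(e <- l) count_mem j e.1)).+1.
have lN e : e \in l -> (count_mem j e.1 < N)%N.
  move=> el; rewrite ltnS leq_max; apply/orP; right.
  exact: (@leq_bigmax_seq _ l xpredT (fun e => count_mem j e.1)).
have := @polynomial_function_coef0 k A N
  (fun d => \sum_(e <- l | count_mem j e.1 == d) rest e.1 *: e.2) char0.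
have -> : \sum_(e <- l | count_mem j e.1 == c) mon sigma e.1 *: e.2 =
    sigma j ^+ c *: \sum_(e <- l | count_mem j e.1 == c) rest e.1 *: e.2.
  rewrite scaler_sumr; apply: eq_bigr => e /eqP ec.
  by rewrite (monE sigma) // ec scalerA.
move=> -> //; rewrite ?scaler0 ?ltnS ?leq_maxl // => x.
pose sigma' i := if i == j then x else sigma i.
rewrite -[RHS](l0 sigma') [RHS](@sum_by_value _ _ _ _ (fun e => count_mem j e.1) (iota 0 N)).
- rewrite -[iota 0 N]/(index_iota 0 N) big_mkord; apply: eq_bigr => d _.
  rewrite scaler_sumr; apply: eq_bigr => e /eqP ed.
  rewrite scalerA (monE sigma') ?ed ?/sigma' ?eqxx //.
  by move=> i /negPf->.
- exact: iota_uniq.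
- by move=> e /lN; rewrite mem_iota.
Qed.

(* Multidegree components are isolated one variable at a time. *)
Lemma sum_mon_transfer (k : fieldType) (J : eqType) (A : lmodType k)
    (W : zmodType) (G : seq J -> {additive A -> W}) (l : seq (seq J * A)) :
  [pchar k] =i pred0 ->
  (forall s s', perm_eq s s' -> G s =1 G s') ->
  (forall sigma : J -> k, \sum_(e <- l) mon sigma e.1 *: e.2 = 0) ->
  \sum_(e <- l) G e.1 e.2 = 0.
Proof.
move=> char0 G_perm.
have [vars] : exists vars : seq J, {in l &, forall e e' : seq J * A,
    forall j, j \notin vars -> count_mem j e.1 = count_mem j e'.1}.
  exists (flatten (map fst l)) => e e' el el' j jl.
  have j0 e1 : e1 \in l -> count_mem j e1.1 = 0%N.
    move=> el1; apply/count_memPn; apply: contra jl => je.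
    by apply/flattenP; exists e1.1 => //; apply: map_f.
  by rewrite !j0.
elim: vars l => [|j vars IH] l l_count l0.
  (* With no variable left, all words are permutations of the first one, so the single additive map
     [G e0.1] serves every entry; the constant [sigma = 1] shows that the coefficients sum to
     zero. *)
  case: l l_count l0 => [|e0 l] l_count l0; first by rewrite big_nil.
  have <- : \sum_(e <- e0 :: l) G e0.1 e.2 = \sum_(e <- e0 :: l) G e.1 e.2.
    apply: eq_big_seq => e el; apply: G_perm; apply/allP => j _ /=.
    by apply/eqP; apply: l_count; rewrite // mem_head.
  rewrite -raddf_sum -[RHS](raddf0 (G e0.1)); congr (G _ _).
  rewrite -[RHS](l0 (fun=> 1)); apply: eq_bigr => e _.
  by rewrite /mon big1 // scale1r.
pose N := (\max_(e <- l) count_mem j e.1).+1.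
rewrite (@sum_by_value _ _ _ _ (fun e => count_mem j e.1) (iota 0 N)).
- apply: big1 => c _; rewrite -big_filter; apply: IH.
    move=> e e'; rewrite !mem_filter => /andP[/eqP ec el] /andP[/eqP ec' el'] i ivars.
    have [->|ij] := eqVneq i j; first by rewrite ec ec'.
    by apply: l_count => //; rewrite inE negb_or ij.
  by move=> sigma; rewrite big_filter; apply: sum_mon_count0.
- exact: iota_uniq.
- move=> e el; rewrite mem_iota /= add0n ltnS.
  exact: (@leq_bigmax_seq _ l xpredT (fun e => count_mem j e.1)).
Qed.

(** * Centred derivatives of identities *)

Section TensorSpan.
Variables (k : fieldType) (U V T : lmodType k) (t : {bilinear U -> V -> T}).

Definition tensor_span : {pred T} :=
  fun x => `[< exists l : seq (U * V), x = \sum_(e <- l) t e.1 e.2 >].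

Lemma tensor_span_closed : subsemimod_closed tensor_span.
Proof.
split; first split.
- by apply/asboolP; exists [::]; rewrite big_nil.
- move=> x y /asboolP[l ->] /asboolP[l' ->]; apply/asboolP.
  by exists (l ++ l'); rewrite big_cat.
- move=> c x /asboolP[l ->]; apply/asboolP.
  exists [seq (c *: e.1, e.2) | e <- l]; rewrite big_map scaler_sumr.
  by apply: eq_bigr => e _; rewrite linearZl_LR.
Qed.

Definition span_sub := {x : T | tensor_span x}.
HB.instance Definition _ := SubChoice.on span_sub.
HB.instance Definition _ :=
  GRing.SubChoice_isSubLmodule.Build k T tensor_span span_sub tensor_span_closed.

Lemma pure_in_span u v : tensor_span (t u v).
Proof. by apply/asboolP; exists [:: (u, v)]; rewrite big_seq1. Qed.

Definition span_pure u v : span_sub := Sub (t u v) (pure_in_span u v).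

Lemma span_pure_bilinear : bilinear_for *:%R *:%R span_pure.
Proof.
split=> [v|u] c x y; apply: val_inj; rewrite linearP !SubK.
  exact: linearPl.
exact: linearPr.
Qed.

HB.instance Definition _ :=
  bilinear_isBilinear.Build k U V span_sub *:%R *:%R span_pure span_pure_bilinear.

(* Corestricting [t] to the span [S] of the pure tensors gives a map [T -> S];
   composed with the inclusion it agrees with the identity on pure tensors,
   hence everywhere. *)
Lemma tensor_generated : is_tensor_product t ->
  forall x, exists l : seq (U * V), x = \sum_(e <- l) t e.1 e.2.
Proof.
move=> tP x; have [f [fE _]] := tP span_sub span_pure.
have [g [_ g_uniq]] := tP T t.
have idE := g_uniq idfun (fun _ _ => erefl).
have fE' u v : ((val : span_sub -> T) \o f) (t u v) = t u v by rewrite /= fE SubK.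
have /= fx := g_uniq ((val : span_sub -> T) \o f) fE' x.
have fxP : tensor_span (sval (f x)) := valP (f x).
by apply/asboolP; move: fxP; rewrite fx -idE.
Qed.

End TensorSpan.

(** * Formal expansion of a polynomial at sums of labelled elements *)

Section Monomials.
Variables (k : fieldType) (Omega : Type) (A : alg k Omega) (J : eqType).
Variable L : nat -> seq (J * A).

Fixpoint monomials (f : poly_expr k Omega) : seq (seq J * A) :=
  match f with
  | Var n => [seq ([:: e.1], e.2) | e <- L n]
  | Zero => [::]
  | Add g h => monomials g ++ monomials h
  | Scale c g => [seq (e.1, c *: e.2) | e <- monomials g]
  | Op w g h =>
      [seq (e.1 ++ e'.1, op A w e.2 e'.2) | e <- monomials g, e' <- monomials h]
  end.

Lemma op_sum (I I' : Type) w (l : seq I) (l' : seq I') (F : I -> A) (F' : I' -> A) :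
  op A w (\sum_(e <- l) F e) (\sum_(e <- l') F' e) =
  \sum_(e <- l) \sum_(e' <- l') op A w (F e) (F' e').
Proof.
by rewrite linear_sumlz; apply: eq_bigr => e _; rewrite linear_sumr.
Qed.

(** Algebras here need not have a unit, so a product over the empty word has no natural value. *)
Lemma monomials_nonempty f : {in monomials f, forall e, e.1 != [::]}.
Proof.
elim: f => [n||g IHg h IHh|c g IHg|w g IHg h IHh] e //=.
- by case/mapP => e' _ ->.
- by rewrite mem_cat => /orP[/IHg|/IHh].
- by case/mapP => e' /IHg e'0 ->.
- by case/allpairsP => -[e1 e2] /= [/IHg + _ ->] /=; case: (e1.1).
Qed.

(** Weighting the labels by arbitrary scalars turns an identity of [A] into the vanishing hypothesis
    of [sum_mon_transfer]. *)
Lemma eval_monomials (sigma : J -> k) f :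
  eval (fun n => \sum_(e <- L n) sigma e.1 *: e.2) f =
  \sum_(e <- monomials f) mon sigma e.1 *: e.2.
Proof.
elim: f => [n||g IHg h IHh|c g IHg|w g IHg h IHh] /=.
- by rewrite big_map; apply: eq_bigr => e _; rewrite /mon big_seq1.
- by rewrite big_nil.
- by rewrite IHg IHh big_cat.
- rewrite IHg scaler_sumr big_map; apply: eq_bigr => e _ /=.
  by rewrite !scalerA mulrC.
- rewrite IHg IHh op_sum big_allpairs_dep; apply: eq_bigr => e _.
  apply: eq_bigr => e' _; rewrite mon_cat linearZl_LR linearZr_LR /= scalerA //.
Qed.

End Monomials.

(** * Commuting left multiplications *)

Section LeftAction.
Variables (k : fieldType) (Q : alg k unit).
Hypothesis mulCA : forall x y z : Q, mul x (mul y z) = mul y (mul x z).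

Fixpoint lact (s : seq Q) (q : Q) : Q :=
  if s is x :: s' then mul x (lact s' q) else q.

Lemma lact_cat s s' q : lact (s ++ s') q = lact s (lact s' q).
Proof. by elim: s => //= x s ->. Qed.

Lemma lactD s : {morph lact s : x y / x + y}.
Proof. by elim: s => //= x s IH y z; rewrite IH /mul linearDr. Qed.

Lemma lact0 s : lact s 0 = 0.
Proof. by elim: s => //= x s ->; rewrite /mul linear0r. Qed.

Lemma lact_mul s x q : lact s (mul x q) = mul x (lact s q).
Proof. by elim: s => //= y s ->; rewrite mulCA. Qed.

Lemma lactC s s' q : lact s (lact s' q) = lact s' (lact s q).
Proof. by elim: s => //= x s IH; rewrite IH lact_mul. Qed.

Lemma lact_perm s s' : perm_eq s s' -> lact s =1 lact s'.
Proof.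
move=> ss' q; pose P s1 := lact s q = lact s1 q.
(* Permutations are generated by exchanges of two adjacent blocks at the front of a word. *)
apply: (@catCA_perm_ind _ P _ s s' ss'); rewrite // /P => s1 s2 s3 ->.
by rewrite !lact_cat lactC.
Qed.

End LeftAction.

(* [central f] is the derivative of [f] with the perturbed occurrence as centre
   of the dialgebra monomial; unperturbed variables are [Var n.*2], perturbed
   ones [Var n.*2.+1]. *)
Fixpoint noncentral (k : fieldType) (Omega : Type) (f : poly_expr k Omega) :
    poly_expr k (di_op Omega) :=
  match f with
  | Var n => Var _ _ n.*2
  | Zero => Zero _ _
  | Add g h => Add (noncentral g) (noncentral h)
  | Scale c g => Scale c (noncentral g)
  | Op w g h => Op (Vdash w) (noncentral g) (noncentral h)
  end.

Fixpoint central (k : fieldType) (Omega : Type) (f : poly_expr k Omega) :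
    poly_expr k (di_op Omega) :=
  match f with
  | Var n => Var _ _ n.*2.+1
  | Zero => Zero _ _
  | Add g h => Add (central g) (central h)
  | Scale c g => Scale c (central g)
  | Op w g h => Add (Op (Vdash w) (noncentral g) (central h))
                    (Op (Dashv w) (central g) (noncentral h))
  end.

(** * Identities of tensor products with perm algebras *)

Section PermTensor.
Variables (k : fieldType) (Omega : Type) (P : alg k unit) (B : alg k Omega).
Variables (D : alg k (di_op Omega)) (t : {bilinear P -> B -> D}).
Hypothesis P_perm : Perm P.
Hypothesis t_op : forall (w : Omega) (p q : P) (a b : B),
  vdash w (t p a) (t q b) = t (mul p q) (op B w a b) /\
  dashv w (t p a) (t q b) = t (mul q p) (op B w a b).

Lemma perm_mulCA (x y z : P) : mul x (mul y z) = mul y (mul x z).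
Proof.
have [<- /eqP] := P_perm x y z; have [<- _] := P_perm y x z.
by rewrite /mul linearBl subr_eq0 => /eqP.
Qed.

Lemma perm_mulA (x y z : P) : mul (mul x y) z = mul x (mul y z).
Proof. by have [] := P_perm x y z. Qed.

(* A label is a pair (value as a non-central factor, value as the centre). *)
Fixpoint nc_prod (s : seq (P * P)) : P :=
  match s with
  | [::] => 0
  | j :: s' => if s' is [::] then j.1 else mul j.1 (nc_prod s')
  end.

(** A Leibniz sum over the choice of centre: each label in turn contributes its second component,
    acted on by the first components of all the others. *)
Fixpoint c_prod (s : seq (P * P)) : P :=
  match s with
  | [::] => 0
  | j :: s' => lact (map fst s') j.2 + mul j.1 (c_prod s')
  end.

Lemma nc_prod_lact s q : s != [::] -> mul (nc_prod s) q = lact (map fst s) q.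
Proof.
elim: s => //= j s IH _; case: s IH => // i s IH.
by rewrite perm_mulA IH.
Qed.

Lemma nc_prod_cat s s' : s != [::] -> s' != [::] ->
  nc_prod (s ++ s') = mul (nc_prod s) (nc_prod s').
Proof.
move=> s0 s'0; rewrite nc_prod_lact //; elim: s s0 => //= j s IH _.
case: s IH => [_|i s IH]; first by case: s' s'0.
by have := congr1 (mul j.1) (IH isT).
Qed.

Lemma c_prod_cat s s' : c_prod (s ++ s') =
  lact (map fst s) (c_prod s') + lact (map fst s') (c_prod s).
Proof.
elim: s => [|j s IH] /=; first by rewrite lact0 addr0.
rewrite IH map_cat lact_cat lactD lact_mul; last exact: perm_mulCA.
rewrite [lact (map fst s) (lact _ _)]lactC; last exact: perm_mulCA.
by rewrite /mul linearDr addrCA.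
Qed.

Lemma c_prod_perm s s' : perm_eq s s' -> c_prod s = c_prod s'.
Proof.
move=> ss'; pose R s1 := c_prod s = c_prod s1.
apply: (@catCA_perm_ind _ R _ s s' ss'); rewrite // /R => s1 s2 s3 ->.
rewrite !c_prod_cat !lactD !map_cat !lact_cat addrAC.
by rewrite [in X in X + _ + _]lactC //; exact: perm_mulCA.
Qed.

Variable l : nat -> seq (P * B).
Let y n := \sum_(e <- l n) t e.1 e.2.
(** Both values of variable [n] share one list: a summand of the unperturbed value vanishes as a
    centre, a summand of the perturbation vanishes as a non-central factor. *)
Let L n := [seq ((e.1, 0 : P), e.2) | e <- l n.*2] ++
           [seq ((0 : P, e.1), e.2) | e <- l n.*2.+1].

Lemma eval_noncentral_perm f :
  eval y (noncentral f) = \sum_(e <- monomials L f) t (nc_prod e.1) e.2.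
Proof.
elim: f => [n||g IHg h IHh|c g IHg|w g IHg h IHh] /=.
- rewrite map_cat big_cat /= !big_map /= [X in _ + X]big1 ?addr0 // => e _.
  exact: linear0l.
- by rewrite big_nil.
- by rewrite IHg IHh big_cat.
- rewrite IHg scaler_sumr big_map; apply: eq_bigr => e _ /=.
  by rewrite linearZr_LR.
- rewrite IHg IHh op_sum big_allpairs_dep; apply: eq_big_seq => e /monomials_nonempty e0.
  apply: eq_big_seq => e' /monomials_nonempty e'0.
  by rewrite nc_prod_cat //; have [] := t_op w (nc_prod e.1) (nc_prod e'.1) e.2 e'.2.
Qed.

Lemma eval_central_perm f :
  eval y (central f) = \sum_(e <- monomials L f) t (c_prod e.1) e.2.
Proof.
elim: f => [n||g IHg h IHh|c g IHg|w g IHg h IHh] /=.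
- rewrite map_cat big_cat /= !big_map /= big1 ?add0r => [|e _].
    by apply: eq_bigr => e _; rewrite /mul linear0r addr0.
  by rewrite /mul linear0r addr0 linear0l.
- by rewrite big_nil.
- by rewrite IHg IHh big_cat.
- rewrite IHg scaler_sumr big_map; apply: eq_bigr => e _ /=.
  by rewrite linearZr_LR.
- rewrite IHg IHh !eval_noncentral_perm !op_sum big_allpairs_dep -big_split.
  apply: eq_big_seq => e /monomials_nonempty e0.
  rewrite -big_split; apply: eq_big_seq => e' /monomials_nonempty e'0 /=.
  rewrite c_prod_cat linearDl -!nc_prod_lact //.
  have [<- _] := t_op w (nc_prod e.1) (c_prod e'.1) e.2 e'.2.
  by have [_ <-] := t_op w (c_prod e.1) (nc_prod e'.1) e.2 e'.2.
Qed.

End PermTensor.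

(** [c_prod] depends only on the multiset of labels, so the value of [central f] is obtained from
    the expansion of [f] in [B], whose multidegree components vanish, by additive maps attached to
    the multidegrees. *)
Lemma holds_in_central_perm (k : fieldType) (Omega : Type) (P : alg k unit)
    (B : alg k Omega) (D : alg k (di_op Omega)) (f : poly_expr k Omega) :
  [pchar k] =i pred0 -> Perm P -> is_perm_tensor P B D -> holds_in f B ->
  holds_in (central f) D.
Proof.
move=> char0 P_perm [t [tP t_op]] fB y.
have [l lE] := choice (fun n => tensor_generated tP (y n)).
rewrite (funext lE) (eval_central_perm P_perm t_op).
apply: (@sum_mon_transfer k (P * P)%type B D (fun s => t (c_prod s)) _ char0).
  by move=> s s' /(c_prod_perm P_perm)->.
by move=> sigma; rewrite -eval_monomials; apply: fB.
Qed.

(** Non-central subterms use [vdash] alone, so their expansion is an instance of [monomials] over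
    this algebra. *)
Definition vdash_alg (k : fieldType) (Omega : Type) (A : alg k (di_op Omega)) :
    alg k Omega :=
  Alg (fun w => op A (Vdash w)).

Lemma eval_ext (k : fieldType) (Omega : Type) (A : alg k Omega) (v v' : nat -> A) f :
  v =1 v' -> eval v f = eval v' f.
Proof. by move=> /funext->. Qed.

Lemma eval_noncentral (k : fieldType) (Omega : Type) (A : alg k (di_op Omega))
    (v : nat -> A) (f : poly_expr k Omega) :
  eval v (noncentral f) = eval (A := vdash_alg A) (fun n => v n.*2) f.
Proof.
by elim: f => //= [g -> h ->|c g ->|w g -> h ->].
Qed.

(** * Identities of box products with pre-commutative algebras *)

Section BoxTensor.
Variables (k : fieldType) (Omega : Type) (Z : alg k unit).
Variables (A : alg k (di_op Omega)) (B : alg k Omega) (t : {bilinear Z -> A -> B}).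
Hypothesis Z_preCom : preCom Z.
Hypothesis A_di : diAlg0 A.
Hypothesis t_op : forall (w : Omega) (z1 z2 : Z) (a b : A),
  op B w (t z1 a) (t z2 b) =
    t (mul z1 z2) (vdash w a b) + t (mul z2 z1) (dashv w a b).

Lemma preCom_mulCA (x y z : Z) : mul x (mul y z) = mul y (mul x z).
Proof. by rewrite -!Z_preCom addrC. Qed.

Lemma vdash_diL w m (u1 u2 u3 : A) :
  vdash w (dashv m u1 u2) u3 = vdash w (vdash m u1 u2) u3.
Proof.
have [/eqP + _] := A_di m w u1 u2 u3.
by rewrite /vdash linearBl subr_eq0 => /eqP.
Qed.

Lemma dashv_diR w m (u1 u2 u3 : A) :
  dashv w u1 (dashv m u2 u3) = dashv w u1 (vdash m u2 u3).
Proof.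
have [_ /eqP] := A_di m w u1 u2 u3.
by rewrite /dashv linearBr subr_eq0 => /eqP.
Qed.

Variable L : nat -> seq (Z * A).

Local Notation nc_monomials := (@monomials k Omega (vdash_alg A) Z L).

(* The entry [((s, z), u)] stands for the monomial with non-central
   coefficients [s] and central coefficient [z]. *)
Fixpoint c_monomials (f : poly_expr k Omega) : seq ((seq Z * Z) * A) :=
  match f with
  | Var n => [seq (([::], e.1), e.2) | e <- L n]
  | Zero => [::]
  | Add g h => c_monomials g ++ c_monomials h
  | Scale c g => [seq (e.1, c *: e.2) | e <- c_monomials g]
  | Op w g h =>
      [seq ((e.1 ++ e'.1.1, e'.1.2), vdash w e.2 e'.2)
         | e <- nc_monomials g, e' <- c_monomials h] ++
      [seq ((e.1.1 ++ e'.1, e.1.2), dashv w e.2 e'.2)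
         | e <- c_monomials g, e' <- nc_monomials h]
  end.

(** The weights of non-central and central values are independent, so [tau] can later single out one
    central coefficient. *)
Lemma eval_c_monomials (sigma tau : Z -> k) f :
  eval (fun n => if odd n then \sum_(e <- L n./2) tau e.1 *: e.2
                 else \sum_(e <- L n./2) sigma e.1 *: e.2) (central f) =
  \sum_(e <- c_monomials f) (mon sigma e.1.1 * tau e.1.2) *: e.2.
Proof.
set v := fun n => _.
have ncE g : eval v (noncentral g) = \sum_(e <- nc_monomials g) mon sigma e.1 *: e.2.
  rewrite eval_noncentral -eval_monomials; apply: (@eval_ext _ _ (vdash_alg A)) => n.
  by rewrite /v odd_double doubleK.
elim: f => [n||g IHg h IHh|c g IHg|w g IHg h IHh] /=.
- rewrite /v /= odd_double /= uphalf_double big_map; apply: eq_bigr => e _.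
  by rewrite /mon big_nil mul1r.
- by rewrite big_nil.
- by rewrite IHg IHh big_cat.
- rewrite IHg scaler_sumr big_map; apply: eq_bigr => e _ /=.
  by rewrite !scalerA mulrC.
- rewrite IHg IHh !ncE !op_sum big_cat !big_allpairs_dep; congr (_ + _).
    apply: eq_bigr => e _; apply: eq_bigr => e' _.
    by rewrite mon_cat linearZl_LR linearZr_LR /= scalerA mulrA.
  apply: eq_bigr => e _; apply: eq_bigr => e' _.
  by rewrite mon_cat linearZl_LR linearZr_LR /= scalerA mulrAC.
Qed.

(* Seen from inside a non-central subterm, the pre-commutative coefficients of
   all choices of centre add up to the action of a single commutative product. *)
Lemma sum_c_monomials_noncentral (W : zmodType) f (b : Z -> A -> W) :
  (forall u, {morph b^~ u : x y / x + y}) ->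
  (forall z w u1 u2, b z (dashv w u1 u2) = b z (vdash w u1 u2)) ->
  forall y, \sum_(e <- c_monomials f) b (mul (lact e.1.1 e.1.2) y) e.2 =
            \sum_(e <- nc_monomials f) b (lact e.1 y) e.2.
Proof.
elim: f b => [n||g IHg h IHh|c g IHg|w g IHg h IHh] b bD b_di y /=.
- by rewrite !big_map.
- by rewrite !big_nil.
- by rewrite !big_cat IHg ?IHh.
- rewrite !big_map /= (IHg (fun z u => b z (c *: u))) // => z w u1 u2.
  by rewrite /dashv /vdash -!linearZl_LR; apply: b_di.
have b_diL z m u1 u2 u3 :
    b z (vdash w (dashv m u1 u2) u3) = b z (vdash w (vdash m u1 u2) u3).
  by rewrite vdash_diL.
have b_diR z m u1 u2 u3 :
    b z (vdash w u1 (dashv m u2 u3)) = b z (vdash w u1 (vdash m u2 u3)).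
  by rewrite -!b_di dashv_diR.
have bMD u : {morph (fun z => b (mul z y) u) : x x' / x + x'}.
  by move=> x x'; rewrite /mul linearDl bD.
rewrite big_cat !big_allpairs_dep /=.
(* By the induction hypotheses each non-central factor is itself a sum over centres; the words with
   centre in [g] and in [h] then pair up through [(ab + ba)y = a(by)]. *)
transitivity (\sum_(e <- c_monomials g) \sum_(e' <- c_monomials h)
    b (mul (lact e.1.1 e.1.2) (mul (lact e'.1.1 e'.1.2) y)) (vdash w e.2 e'.2)).
  rewrite exchange_big /=.
  transitivity (\sum_(e' <- c_monomials h) \sum_(e <- c_monomials g)
      b (mul (mul (lact e.1.1 e.1.2) (lact e'.1.1 e'.1.2)) y) (vdash w e.2 e'.2) +
    \sum_(e <- c_monomials g) \sum_(e' <- c_monomials h)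
      b (mul (mul (lact e'.1.1 e'.1.2) (lact e.1.1 e.1.2)) y) (vdash w e.2 e'.2)).
    congr (_ + _); apply: eq_bigr => e _.
      rewrite (IHg (fun z u => b (mul z y) (vdash w u e.2))) //.
      by apply: eq_bigr => e' _; rewrite lact_cat.
    rewrite (IHh (fun z u => b (mul z y) (vdash w e.2 u))) //.
    by apply: eq_bigr => e' _; rewrite lact_cat b_di (lactC preCom_mulCA).
  rewrite [X in X + _]exchange_big -big_split; apply: eq_bigr => e _ /=.
  rewrite -big_split; apply: eq_bigr => e' _ /=.
  by rewrite -bMD Z_preCom.
(* The same hypotheses, first for [g] and then for [h], now absorb both factors into the left action
   on [y]. *)
rewrite exchange_big /=.
under eq_bigr => e _ do
  rewrite (IHg (fun z u => b z (vdash w u e.2)) (fun u => bD _)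
               (fun z m u1 u2 => b_diL z m u1 u2 e.2)).
rewrite exchange_big /=; apply: eq_bigr => e _.
under eq_bigr => e' _ do rewrite (lact_mul preCom_mulCA).
rewrite (IHh (fun z u => b z (vdash w e.2 u))) //; apply: eq_bigr => e' _.
by rewrite lact_cat (lactC preCom_mulCA).
Qed.

(** Each of the two terms of a product has one factor in non-central position, where the sum over
    its centres collapses to [nc_monomials]. *)
Lemma eval_box f :
  eval (fun n => \sum_(e <- L n) t e.1 e.2) f =
  \sum_(e <- c_monomials f) t (lact e.1.1 e.1.2) e.2.
Proof.
elim: f => [n||g IHg h IHh|c g IHg|w g IHg h IHh] /=.
- by rewrite big_map.
- by rewrite big_nil.
- by rewrite IHg IHh big_cat.
- rewrite IHg scaler_sumr big_map; apply: eq_bigr => e _ /=.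
  by rewrite linearZr_LR.
rewrite IHg IHh op_sum big_cat !big_allpairs_dep /=.
under eq_bigr => e _ do under eq_bigr => e' _ do rewrite t_op.
under eq_bigr => e _ do rewrite big_split.
rewrite big_split /=; congr (_ + _).
  rewrite exchange_big [RHS]exchange_big /=; apply: eq_bigr => e _.
  under [RHS]eq_bigr => e' _ do rewrite lact_cat.
  apply: (@sum_c_monomials_noncentral _ g (fun z u => t z (vdash w u e.2))).
    by move=> u x x'; rewrite linearDl.
  by move=> z m u1 u2; rewrite vdash_diL.
apply: eq_bigr => e _.
under [RHS]eq_bigr => e' _ do rewrite lact_cat (lactC preCom_mulCA).
apply: (@sum_c_monomials_noncentral _ h (fun z u => t z (dashv w e.2 u))).
  by move=> u x x'; rewrite linearDl.
by move=> z m u1 u2; rewrite dashv_diR.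
Qed.

End BoxTensor.

Lemma holds_in_box (k : fieldType) (Omega : Type) (Z : alg k unit)
    (A : alg k (di_op Omega)) (B : alg k Omega) (f : poly_expr k Omega) :
  [pchar k] =i pred0 -> preCom Z -> diAlg0 A -> is_box_tensor Z A B ->
  holds_in (central f) A -> holds_in f B.
Proof.
move=> char0 Z_preCom A_di [t [tP t_op]] fA v.
have [L LE] := choice (fun n => tensor_generated tP (v n)).
rewrite (funext LE) (eval_box Z_preCom A_di t_op).
set l := c_monomials L f.
(* The entries are grouped by central coefficient [z]; within a group only the symmetric left action
   on [z] varies. *)
rewrite (@sum_by_value _ _ _ l (fun e => e.1.2) (undup [seq e.1.2 | e <- l])).
- apply: big1 => z _.
  have /= := @sum_mon_transfer k Z A B (fun s => t (lact s z))
    [seq (e.1.1, e.2) | e <- l & e.1.2 == z] char0.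
  rewrite big_map big_filter /=.
  move=> T0; rewrite -[RHS]T0; first by apply: eq_bigr => e /eqP->.
    by move=> s s' /(lact_perm (preCom_mulCA Z_preCom))->.
  move=> sigma; rewrite big_map big_filter /=.
  (* Perturbing by the indicator of [z] keeps exactly the monomials with central coefficient [z]. *)
  rewrite -[RHS](fA (fun n => if odd n then \sum_(e <- L n./2) (e.1 == z)%:R *: e.2
                 else \sum_(e <- L n./2) sigma e.1 *: e.2)).
  rewrite (eval_c_monomials L sigma (fun z' => (z' == z)%:R)) big_mkcond.
  apply: eq_bigr => e _; case: eqP => _; first by rewrite mulr1.
  by rewrite mulr0 scale0r.
- exact: undup_uniq.
- by move=> e el; rewrite mem_undup; apply: (map_f (fun e => e.1.2)).
Qed.

(** * Recovering a dialgebra from a perm and a pre-commutative tensor factor *)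

Section ZinbielPoly.
Variable k : fieldType.
Implicit Types p q r : {poly k}.

Definition integral p : {poly k} := \poly_(i < (size p).+1) (p`_i.-1 / i%:R).

(* The coefficient at [i = 0] is [0] because of the convention [0^-1 = 0]. *)
Lemma coef_integral p i : (integral p)`_i = p`_i.-1 / i%:R.
Proof.
rewrite coef_poly; case: ltnP => // lt_pi.
by rewrite [p`_i.-1]nth_default ?mul0r //; case: i lt_pi.
Qed.

Lemma integralP c p q : integral (c *: p + q) = c *: integral p + integral q.
Proof.
by apply/polyP=> i; rewrite !(coefD, coefZ, coef_integral) mulrDl mulrA.
Qed.

Definition tailp p : {poly k} := p - (p`_0)%:P.

Lemma tailpP c p q : tailp (c *: p + q) = c *: tailp p + tailp q.
Proof.
rewrite /tailp coefD coefZ polyCD polyCM mul_polyC scalerBr opprD.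
by rewrite addrACA.
Qed.

Lemma coef_tailp p i : (tailp p)`_i = if i == 0%N then 0 else p`_i.
Proof. by rewrite coefB coefC; case: eqP => [->|_]; rewrite ?subrr ?subr0. Qed.

(* Here ['X^n] with [n > 0] multiply by [p . q = \int p q'], while ['X^0] is a
   separate square-zero element on which these powers act through [p |-> p(1)]. *)
Definition zmul p q : {poly k} :=
  integral (tailp p * q^`()) + ((tailp p).[1] * q`_0)%:P.

Lemma zmulPl c p r q : zmul (c *: p + r) q = c *: zmul p q + zmul r q.
Proof.
rewrite /zmul tailpP mulrDl -scalerAl integralP hornerD hornerZ scalerDr.
by rewrite -[c *: _%:P]mul_polyC -polyCM mulrA addrACA -polyCD -mulrDl.
Qed.

Lemma zmulPr p c q r : zmul p (c *: q + r) = c *: zmul p q + zmul p r.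
Proof.
rewrite /zmul derivD derivZ mulrDr -scalerAr integralP coefD coefZ scalerDr.
by rewrite -[c *: _%:P]mul_polyC -polyCM mulrCA addrACA -polyCD -mulrDr.
Qed.

Lemma zmul_bilinear : bilinear_for *:%R *:%R zmul.
Proof. by split=> [q|p] c r s; [exact: zmulPl | exact: zmulPr]. Qed.

HB.instance Definition _ :=
  bilinear_isBilinear.Build k {poly k} {poly k} {poly k} *:%R *:%R zmul zmul_bilinear.

Definition zinb : alg k unit := @Alg k unit {poly k} (fun=> zmul : {bilinear _ -> _ -> _}).

Hypothesis char0 : [pchar k] =i pred0.

Lemma natrS_neq0 n : n.+1%:R != 0 :> k.
Proof. by move/pcharf0P: char0 => ->. Qed.

Lemma deriv_integral p : (integral p)^`() = p.
Proof.
apply/polyP=> i; rewrite coef_deriv coef_integral /=.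
by rewrite -[LHS]mulr_natr divfK // natrS_neq0.
Qed.

Lemma integral_deriv p : integral p^`() = tailp p.
Proof.
apply/polyP=> -[|i]; rewrite coef_integral coef_tailp /=.
  by rewrite invr0 mulr0.
by rewrite coef_deriv -[_ *+ i.+1]mulr_natr mulfK // natrS_neq0.
Qed.

Lemma tailp_zmul p q : tailp (zmul p q) = integral (tailp p * q^`()).
Proof.
apply/polyP=> i; rewrite coef_tailp coefD coefC; case: eqP => [->|_].
  by rewrite coef_integral invr0 mulr0.
by rewrite addr0.
Qed.

Lemma deriv_tailp p : (tailp p)^`() = p^`().
Proof. by rewrite derivB derivC subr0. Qed.

Lemma tailpD p q : tailp (p + q) = tailp p + tailp q.
Proof. by rewrite -[p in LHS]scale1r tailpP scale1r. Qed.

(** Integration by parts, without boundary term because tails vanish at 0. *)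
Lemma tailp_zmulC p q : tailp (zmul p q + zmul q p) = tailp p * tailp q.
Proof.
rewrite tailpD !tailp_zmul -[X in X + _]scale1r -integralP scale1r.
rewrite -[q^`()]deriv_tailp -[p^`()]deriv_tailp [X in _ + X]mulrC addrC -derivM.
rewrite integral_deriv; apply/polyP=> i; rewrite coef_tailp; case: eqP => // ->.
by rewrite coef0M !coef_tailp mul0r.
Qed.

(** In positive degree both sides integrate the tails of [p] and [q] times the derivative of [r]; in
    degree 0 evaluation at 1 is multiplicative. *)
Lemma zinb_preCom : preCom zinb.
Proof.
move=> p q r; rewrite /mul /= {1}/zmul tailp_zmulC {2}/zmul.
rewrite /zmul derivD derivC addr0 deriv_integral mulrA hornerM; congr (_ + _%:P).
by rewrite coefD coefC eqxx coef_integral invr0 mulr0 add0r mulrA.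
Qed.

(** The range omits both ends: [tailp] removes the constant term of [p], and the derivative that of
    [q]. *)
Lemma coef_zmul p q n :
  (zmul p q)`_n.+1 =
  n.+1%:R^-1 * \sum_(1 <= i < n.+1) (n.+1 - i)%:R * (p`_i * q`_(n.+1 - i)).
Proof.
rewrite coefD coefC addr0 coef_integral /= mulrC coefM; congr (_ * _).
rewrite big_ord_recl coef_tailp mul0r add0r big_add1 big_mkord /=.
apply: eq_bigr => i _; rewrite coef_tailp /= /bump /= add1n coef_deriv subSS.
by rewrite subnSK // mulrnAr mulr_natl.
Qed.

Lemma coef0_zmul p q : (zmul p q)`_0 = (tailp p).[1] * q`_0.
Proof. by rewrite coefD coefC coef_integral invr0 mulr0 add0r. Qed.

End ZinbielPoly.

(** * A model of the tensor product of the polynomials with a space *)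

Section FiniteSupport.
Variables (k : fieldType) (A : lmodType k).

Definition supp_le (x : nat -> A) (N : nat) := forall n, (N <= n)%N -> x n = 0.

Definition finite_supp : {pred nat -> A} := fun x => `[< exists N, supp_le x N >].

Lemma finite_supp_closed : subsemimod_closed finite_supp.
Proof.
split; first split.
- by apply/asboolP; exists 0%N.
- move=> x y /asboolP[N xN] /asboolP[M yM]; apply/asboolP.
  exists (maxn N M) => n; rewrite geq_max => /andP[Nn Mn].
  by rewrite -[LHS]/(x n + y n) xN // yM // addr0.
- move=> c x /asboolP[N xN]; apply/asboolP; exists N => n Nn.
  by rewrite -[LHS]/(c *: x n) xN // scaler0.
Qed.

(** These sequences are polynomials with coefficients in [A], the entry at [n] being the coefficient
    of ['X^n]. *)
Definition fsup := {x : nat -> A | finite_supp x}.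
HB.instance Definition _ := SubChoice.on fsup.
HB.instance Definition _ :=
  GRing.SubChoice_isSubLmodule.Build k (nat -> A) finite_supp fsup finite_supp_closed.

Definition coefs (x : fsup) : nat -> A := val x.

Lemma coefs_inj (x y : fsup) : coefs x =1 coefs y -> x = y.
Proof. by move=> /funext /val_inj. Qed.

Lemma coefsP c (x y : fsup) n : coefs (c *: x + y) n = c *: coefs x n + coefs y n.
Proof. by rewrite /coefs linearP. Qed.

Lemma fsup_bound (x : fsup) : exists N, supp_le (coefs x) N.
Proof. exact/asboolP/(valP x). Qed.

Definition bound (x : fsup) : nat := sval (cid (fsup_bound x)).

Lemma boundP x : supp_le (coefs x) (bound x).
Proof. exact: svalP (cid (fsup_bound x)). Qed.

Definition mk_fsup (x : nat -> A) N (xN : supp_le x N) : fsup :=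
  Sub x (asboolT (ex_intro _ N xN)).

Lemma coefs_mk x N (xN : supp_le x N) : coefs (mk_fsup xN) = x.
Proof. by rewrite /coefs SubK. Qed.

Section LinearExtension.
Variables (W : lmodType k) (F : nat -> {linear A -> W}).

Definition ext (x : fsup) : W := \sum_(n < bound x) F n (coefs x n).

(** [bound] comes from choice, so a common range of summation for several elements requires
    independence of the bound; both bounds are compared with their sum. *)
Lemma extE x N : supp_le (coefs x) N -> ext x = \sum_(n < N) F n (coefs x n).
Proof.
move=> xN; have widen M M' : supp_le (coefs x) M ->
    \sum_(n < M) F n (coefs x n) = \sum_(n < M + M') F n (coefs x n).
  move=> xM; rewrite -!(big_mkord xpredT (fun n => F n (coefs x n))).
  rewrite [RHS](big_cat_nat (leq0n M)) ?leq_addr //= [X in _ + X]big_nat.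
  by rewrite [X in _ + X]big1 ?addr0 // => n /andP[Mn _]; rewrite xM // raddf0.
by rewrite /ext (widen _ N (@boundP x)) addnC -widen.
Qed.

Lemma ext_linear : linear ext.
Proof.
move=> c x y; pose N := maxn (bound x) (bound y).
have xN : supp_le (coefs x) N.
  by move=> n; rewrite geq_max => /andP[/boundP-> _].
have yN : supp_le (coefs y) N.
  by move=> n; rewrite geq_max => /andP[_ /boundP->].
have xyN : supp_le (coefs (c *: x + y)) N.
  by move=> n Nn; rewrite coefsP xN // yN // scaler0 addr0.
rewrite (extE xN) (extE yN) (extE xyN) scaler_sumr -big_split.
by apply: eq_bigr => n _; rewrite coefsP linearP.
Qed.

HB.instance Definition _ := GRing.isLinear.Build k fsup W *:%R ext ext_linear.

End LinearExtension.

Lemma pure_supp (p : {poly k}) (a : A) : supp_le (fun n => p`_n *: a) (size p).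
Proof. by move=> n pn; rewrite nth_default // scale0r. Qed.

Definition pure (p : {poly k}) (a : A) : fsup := mk_fsup (@pure_supp p a).

Lemma coefs_pure p a n : coefs (pure p a) n = p`_n *: a.
Proof. by rewrite coefs_mk. Qed.

Lemma pure_bilinear : bilinear_for *:%R *:%R pure.
Proof.
split=> [a c p q|p c a b]; apply: coefs_inj => n; rewrite coefsP !coefs_pure.
  by rewrite coefD coefZ scalerDl scalerA.
by rewrite scalerDr !scalerA mulrC.
Qed.

HB.instance Definition _ :=
  bilinear_isBilinear.Build k {poly k} A fsup *:%R *:%R pure pure_bilinear.

Lemma ext_pure (W : lmodType k) (F : nat -> {linear A -> W}) p a :
  ext F (pure p a) = \sum_(n < size p) p`_n *: F n a.
Proof.
rewrite (@extE _ _ _ (size p)); last first.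
  by move=> n pn; rewrite coefs_pure nth_default ?scale0r.
by apply: eq_bigr => n _; rewrite coefs_pure linearZ.
Qed.

Lemma coefs_sum I (l : seq I) (F : I -> fsup) n :
  coefs (\sum_(i <- l) F i) n = \sum_(i <- l) coefs (F i) n.
Proof.
elim: l => [|i l IH]; first by rewrite !big_nil.
by rewrite !big_cons -IH -[F i in LHS]scale1r coefsP scale1r.
Qed.

Lemma pure_sum x : x = \sum_(n < bound x) pure 'X^n (coefs x n).
Proof.
apply: coefs_inj => n; rewrite coefs_sum.
under eq_bigr => i _ do rewrite coefs_pure coefXn.
case: (ltnP n (bound x)) => [lt_n|/[dup]/boundP-> le_n].
  rewrite (bigD1 (Ordinal lt_n)) //= eqxx scale1r big1 ?addr0 // => i /eqP in0.
  by rewrite (_ : n == i = false) ?scale0r //; apply/eqP => ni; apply/in0/val_inj.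
rewrite big1 // => i _; rewrite (_ : n == i = false) ?scale0r //.
by rewrite gtn_eqF // (leq_trans (ltn_ord i)).
Qed.

Lemma pure_tensor : is_tensor_product (pure : {bilinear _ -> _ -> _}).
Proof.
move=> W b; exists (ext (fun n => b 'X^n) : {linear _ -> _}); split=> [p a|g gE x].
  rewrite /= ext_pure -[in RHS](coefK p) poly_def linear_sumlz.
  by apply: eq_bigr => n _; rewrite linearZl_LR.
by rewrite [x in LHS]pure_sum raddf_sum; apply: eq_bigr => n _; apply: gE.
Qed.

(** Evaluation at 1 of the part divisible by ['X]; through it this part acts on the square-zero
    element ['X^0]. *)
Definition tail_sum : fsup -> A :=
  ext (fun n => if n is 0 then \0 : {linear A -> A} else idfun : {linear A -> A}).

HB.instance Definition _ := GRing.Linear.on tail_sum.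

Lemma tail_sum_pure p a : tail_sum (pure p a) = (tailp p).[1] *: a.
Proof.
rewrite /tail_sum ext_pure.
rewrite (@horner_coef_wide _ (size p)); last first.
  by apply/leq_sizeP => j pj; rewrite coef_tailp nth_default // if_same.
rewrite scaler_suml; apply: eq_bigr => -[[|n] ltn] _ /=.
  by rewrite coef_tailp scaler0 mul0r scale0r.
by rewrite coef_tailp expr1n mulr1.
Qed.

End FiniteSupport.

(** * The box product with the polynomial algebra *)

Section ZinbielBox.
Variables (k : fieldType) (Omega : Type) (A : alg k (di_op Omega)).
Implicit Types x y z : fsup A.

(** The weights come from ['X^i . 'X^m = m/(i+m) 'X^(i+m)]; the common denominator is left to
    [box_coefs]. *)
Definition box_term (w : Omega) (m i : nat) (u v : A) : A :=
  m%:R *: vdash w u v + i%:R *: dashv w u v.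

Lemma box_termPl w m i c u u' v :
  box_term w m i (c *: u + u') v = c *: box_term w m i u v + box_term w m i u' v.
Proof.
by rewrite /box_term /vdash /dashv !linearPl !scalerDr !scalerA ![_ * c]mulrC addrACA.
Qed.

Lemma box_termPr w m i c u v v' :
  box_term w m i u (c *: v + v') = c *: box_term w m i u v + box_term w m i u v'.
Proof.
by rewrite /box_term /vdash /dashv !linearPr !scalerDr !scalerA ![_ * c]mulrC addrACA.
Qed.

Definition box_coefs (w : Omega) x y (n : nat) : A :=
  if n is m.+1 then
    n%:R^-1 *: \sum_(1 <= i < n) box_term w (n - i) i (coefs x i) (coefs y (n - i))
  else vdash w (tail_sum x) (coefs y 0) + dashv w (coefs x 0) (tail_sum y).

Lemma box_supp w x y : supp_le (box_coefs w x y) (bound x + bound y).+1.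
Proof.
case=> // n le_n; rewrite /box_coefs big_nat big1 ?scaler0 // => i /andP[i0 i_n].
rewrite /box_term /vdash /dashv; case: (leqP (bound x) i) => [xi|ix].
  by rewrite (boundP xi) !linear0l !scaler0 addr0.
rewrite (_ : coefs y (n.+1 - i) = 0) ?linear0r ?scaler0 ?addr0 //.
apply: boundP; rewrite leq_subRL ?(ltnW i_n) //.
by apply: leq_trans (ltnW le_n); rewrite leq_add2r ltnW.
Qed.

Definition box_op w x y : fsup A := mk_fsup (@box_supp w x y).

Lemma coefs_box w x y : coefs (box_op w x y) = box_coefs w x y.
Proof. exact: coefs_mk. Qed.

Lemma box_bilinear w : bilinear_for *:%R *:%R (box_op w).
Proof.
split=> [z|z] c x y; apply: coefs_inj => -[|n]; rewrite coefsP !coefs_box /=.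
- by rewrite /vdash /dashv coefsP linearP linearPl linearPl scalerDr addrACA.
- rewrite scalerA [c * _]mulrC -scalerA -scalerDr; congr (_ *: _).
  rewrite scaler_sumr -big_split; apply: eq_bigr => i _; rewrite coefsP; exact: box_termPl.
- by rewrite /vdash /dashv coefsP !linearP scalerDr addrACA.
rewrite scalerA [c * _]mulrC -scalerA -scalerDr; congr (_ *: _).
rewrite scaler_sumr -big_split; apply: eq_bigr => i _; rewrite coefsP; exact: box_termPr.
Qed.

HB.instance Definition _ w :=
  bilinear_isBilinear.Build k (fsup A) (fsup A) (fsup A) *:%R *:%R
    (box_op w) (box_bilinear w).

Definition zinb_box : alg k Omega :=
  @Alg k Omega (fsup A) (fun w => box_op w : {bilinear _ -> _ -> _}).

Lemma box_op_pure w (p q : {poly k}) (a b : A) :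
  box_op w (pure p a) (pure q b) =
  pure (zmul p q) (vdash w a b) + pure (zmul q p) (dashv w a b).
Proof.
apply: coefs_inj => n; rewrite -[pure (zmul p q) _]scale1r coefsP scale1r.
rewrite !coefs_pure coefs_box; case: n => [|n] /=.
  rewrite !tail_sum_pure !coefs_pure !coef0_zmul /vdash /dashv.
  by rewrite !linearZl_LR !linearZr_LR /= !scalerA [p`_0 * _]mulrC.
rewrite !coef_zmul -!scalerA -scalerDr; congr (_ *: _).
(* The coefficient of [zmul q p] is summed over degrees in [q]; after reversal both sums run over
   degrees in [p]. *)
rewrite [X in _ + X *: _]big_nat_rev /= !scaler_suml -big_split.
apply: eq_big_nat => i /andP[i0 i_n].
rewrite add1n subSS subKn ?(ltnW i_n) // !coefs_pure /box_term /vdash /dashv.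
by rewrite !linearZl_LR !linearZr_LR /= !scalerA [q`_(_ - _) * _]mulrC !mulrA.
Qed.

Lemma zinb_box_tensor : is_box_tensor (zinb k) A zinb_box.
Proof.
exists (@pure k A : {bilinear {poly k} -> A -> fsup A}); split; first exact: pure_tensor.
by move=> w p q a b; apply: box_op_pure.
Qed.

End ZinbielBox.

(** * The tensor product with the two-dimensional perm algebra *)

Section PermSquare.
Variables (k : fieldType) (Omega : Type).

Definition perm2_mul (p q : (k^o * k^o)%type) : (k^o * k^o)%type := p.1 *: q.

Lemma perm2_bilinear : bilinear_for *:%R *:%R perm2_mul.
Proof.
split=> [r|p] c q s; rewrite /perm2_mul /=.
  by rewrite scalerDl scalerA.
by rewrite scalerDr !scalerA mulrC.
Qed.

HB.instance Definition _ :=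
  bilinear_isBilinear.Build k _ _ _ *:%R *:%R perm2_mul perm2_bilinear.

Definition perm2 : alg k unit :=
  @Alg k unit (k^o * k^o)%type (fun=> perm2_mul : {bilinear _ -> _ -> _}).

Lemma perm2_Perm : Perm perm2.
Proof.
move=> p q r; rewrite /mul /= /perm2_mul /=; split; first by rewrite scalerA.
by rewrite [q.1 *: p.1]mulrC subrr scale0r.
Qed.

Variable B : alg k Omega.

(** A pair stands for [e1 (x) x.1 + e2 (x) x.2]; since [e1] is a left unit and [e2] annihilates from
    the left, the second component enters only through the centre. *)
Definition square_op (i : di_op Omega) (x y : B * B) : B * B :=
  match i with
  | Vdash w => (op B w x.1 y.1, op B w x.1 y.2)
  | Dashv w => (op B w x.1 y.1, op B w x.2 y.1)
  end.

Lemma square_bilinear i : bilinear_for *:%R *:%R (square_op i).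
Proof.
by split=> [z|z] c x y; case: i => w; rewrite /square_op /= ?linearPl ?linearPr.
Qed.

HB.instance Definition _ i :=
  bilinear_isBilinear.Build k _ _ _ *:%R *:%R (square_op i) (square_bilinear i).

Definition square : alg k (di_op Omega) :=
  @Alg k (di_op Omega) (B * B)%type (fun i => square_op i : {bilinear _ -> _ -> _}).

Definition square_pure (p : (k^o * k^o)%type) (x : B) : (B * B)%type := (p.1 *: x, p.2 *: x).

Lemma square_pure_bilinear : bilinear_for *:%R *:%R square_pure.
Proof.
split=> [x|p] c q s; rewrite /square_pure /=; congr (_, _).
- by rewrite scalerDl /= scalerA.
- by rewrite scalerDl /= scalerA.
- by rewrite scalerDr /= !scalerA mulrC.
- by rewrite scalerDr /= !scalerA mulrC.
Qed.

HB.instance Definition _ :=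
  bilinear_isBilinear.Build k _ _ _ *:%R *:%R square_pure square_pure_bilinear.

Lemma square_perm_tensor : is_perm_tensor perm2 B square.
Proof.
exists (square_pure : {bilinear _ -> _ -> _}); split=> [W b|w p q x y]; last first.
  rewrite /vdash /dashv /= /square_pure /= /mul /= /perm2_mul /=.
  rewrite !linearZl_LR !linearZr_LR /= !scalerA; split=> //.
  by rewrite [p.1 * _]mulrC [p.2 * _]mulrC.
pose f (z : B * B) : W := b (1, 0) z.1 + b (0, 1) z.2.
have f_lin : linear f.
  by move=> c x y; rewrite /f !linearPr scalerDr addrACA.
pose fM := GRing.isLinear.Build k (B * B)%type W *:%R f f_lin.
pose fL : {linear (B * B)%type -> W} := HB.pack f fM.
exists fL; split=> [p x|g gE [x y]].
  rewrite /= /f /= !linearZr_LR /= -!linearZl_LR -linearDl; congr (b _ x).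
  by case: p => p1 p2; congr (_, _); rewrite /= scaler0 [_ *: 1]mulr1 ?addr0 ?add0r.
rewrite /= /f /= -!gE -raddfD; congr (g _).
transitivity ((x, 0) + (0, y) : (B * B)%type).
  by congr (_, _); rewrite /= ?addr0 ?add0r.
by congr (_ + _); congr (_, _); symmetry; by [exact: scale1r | exact: scale0r].
Qed.

End PermSquare.

(** * Recovering the values of polynomials in the dialgebra *)

Section Reconstruction.
Variables (k : fieldType) (Omega : Type) (A : alg k (di_op Omega)).
Hypothesis char0 : [pchar k] =i pred0.
Hypothesis A_di : diAlg0 A.

Let T := zinb_box A.

Definition noncentral_null (u : A) : Prop :=
  forall w y, vdash w u y = 0 /\ dashv w y u = 0.

(* [represents x a] holds for the value [x] of a polynomial at the elements
   [('X (x) a, 1 (x) a)] and its value [a] in [A]. *)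
Definition represents (x : square T) (a : A) : Prop :=
  [/\ coefs x.1 0 = 0, noncentral_null (tail_sum x.1 - a) & x.2 = pure 1 a].

Lemma noncentral_null_lin c u v : noncentral_null u -> noncentral_null v ->
  noncentral_null (c *: u + v).
Proof.
move=> u0 v0 w y; have [ul ur] := u0 w y; have [vl vr] := v0 w y.
move: ul ur vl vr; rewrite /vdash /dashv linearPl linearPr.
by move=> -> -> -> ->; rewrite scaler0 addr0.
Qed.

Lemma noncentral_null0 : noncentral_null 0.
Proof. by move=> w y; rewrite /vdash /dashv linear0l linear0r. Qed.

Lemma noncentral_nullB w u v : noncentral_null (vdash w u v - dashv w u v).
Proof. by move=> m y; have [-> _] := A_di w m u v y; have [_ ->] := A_di w m y u v. Qed.

Lemma noncentral_nullD u v : noncentral_null u -> noncentral_null v ->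
  noncentral_null (u + v).
Proof. by move=> u0 v0; rewrite -[u]scale1r; apply: noncentral_null_lin. Qed.

Lemma noncentral_nullN u : noncentral_null u -> noncentral_null (- u).
Proof.
by move=> u0; rewrite -[- u]addr0 -scaleN1r; apply: noncentral_null_lin noncentral_null0.
Qed.

Lemma noncentral_null_sum I (l : seq I) (F : I -> A) :
  (forall i, noncentral_null (F i)) -> noncentral_null (\sum_(i <- l) F i).
Proof.
move=> F0; elim/big_ind: _ => //; first exact: noncentral_null0.
exact: noncentral_nullD.
Qed.

(** On pure tensors the values at 1 of the two products of tails add up to the product of the
    values, so the error is a multiple of [dashv] minus [vdash]. *)
Lemma tail_sum_box w (x y : T) :
  noncentral_null (tail_sum (op T w x y) - vdash w (tail_sum x) (tail_sum y)).
Proof.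
rewrite (pure_sum x) (pure_sum y) linear_sumlz !raddf_sum /vdash linear_sumlz -sumrB.
apply: noncentral_null_sum => i; rewrite linear_sumr raddf_sum linear_sumr -sumrB.
apply: noncentral_null_sum => j; rewrite /= box_op_pure raddfD /= !tail_sum_pure.
set p := 'X^i; set q := 'X^j; set a := coefs x i; set b := coefs y j.
rewrite linearZl_LR linearZr_LR /= scalerA -hornerM -tailp_zmulC // tailpD.
rewrite [(tailp _ + _).[1]]hornerD scalerDl opprD addrACA subrr add0r -scalerBr -[_ *: _]addr0.
apply: noncentral_null_lin noncentral_null0.
by rewrite -opprB; apply/noncentral_nullN/noncentral_nullB.
Qed.

Lemma represents_vdash w x y a b : represents x a -> represents y b ->
  represents (op (square T) (Vdash w) x y) (vdash w a b).
Proof.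
move=> [x0 xa x2] [y0 yb y2]; split.
- by rewrite /= coefs_box /= x0 y0 /vdash /dashv linear0l linear0r addr0.
- rewrite -[_ - _](subrKA (vdash w (tail_sum x.1) (tail_sum y.1))).
  apply: noncentral_nullD; first exact: tail_sum_box.
  rewrite -[_ - _](subrKA (vdash w a (tail_sum y.1))).
  apply: noncentral_nullD.
    rewrite /vdash -linearBl; have [+ _] := xa w (tail_sum y.1).
    by rewrite /vdash => ->; exact: noncentral_null0.
  (* Here the null element is the centre of [vdash] and its product may be nonzero; but the [dashv]
     product is zero, and the two differ by a null element. *)
  rewrite /vdash -linearBr -[op A _ _ _]subr0.
  by have [_ <-] := yb w a; apply: noncentral_nullB.
(* Since [y.2] lives in degree 0, [x.1] acts on it through [tail_sum x.1], which may be replaced by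
   [a] in this non-central position; in higher degrees [n - i > 0] kills every term. *)
rewrite /= y2; apply: coefs_inj => -[|n]; rewrite coefs_box coefs_pure coef1 /=.
  rewrite coefs_pure coef1 scale1r x0 /dashv linear0l addr0 scale1r.
  by apply/eqP; rewrite -subr_eq0 /vdash -linearBl; have [/eqP] := xa w b.
rewrite scale0r big_nat big1 ?scaler0 // => i /andP[i0 i_n].
rewrite coefs_pure coef1 /box_term /vdash /dashv subn_eq0 leqNgt i_n scale0r.
by rewrite !linear0r !scaler0 addr0.
Qed.

Lemma represents_dashv w x y a b : represents x a -> represents y b ->
  represents (op (square T) (Dashv w) x y) (dashv w a b).
Proof.
(* The first components of the two products in [square T] coincide, so two of the conditions come
   from the [vdash] case. *)
move=> xa yb; have [r0 r1 _] := represents_vdash w xa yb.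
move: xa yb => [x0 _ x2] [y0 yb y2]; split=> //.
- rewrite -[_ - _](subrKA (vdash w a b)); apply: noncentral_nullD => //.
  exact: noncentral_nullB.
rewrite /= x2; apply: coefs_inj => -[|n]; rewrite coefs_box coefs_pure coef1 /=.
  rewrite coefs_pure coef1 !scale1r y0 /vdash linear0r add0r.
  by apply/eqP; rewrite -subr_eq0 /dashv -linearBr; have [_ /eqP] := yb w a.
rewrite scale0r big_nat big1 ?scaler0 // => -[|i] // _.
rewrite coefs_pure coef1 /box_term /vdash /dashv scale0r.
by rewrite !linear0l !scaler0 addr0.
Qed.

Lemma represents_lin c x y a b : represents x a -> represents y b ->
  represents (c *: x + y) (c *: a + b).
Proof.
move=> [x0 xa x2] [y0 yb y2]; split.
- by rewrite coefsP x0 y0 scaler0 addr0.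
- by rewrite linearP opprD addrACA -scalerBr; apply: noncentral_null_lin.
by rewrite /= x2 y2 linearPr.
Qed.

Lemma represents0 : represents 0 0.
Proof.
split=> //; last by rewrite linear0r.
by rewrite linear0 subrr; exact: noncentral_null0.
Qed.

Lemma represents_eval (v : nat -> A) f :
  represents (eval (A := square T) (fun n => (pure 'X (v n), pure 1 (v n))) f)
             (eval v f).
Proof.
elim: f => [n||g IHg h IHh|c g IHg|[w|w] g IHg h IHh] /=.
- split=> //=; first by rewrite coefs_pure coefX scale0r.
  rewrite tail_sum_pure /tailp coefX subr0 hornerX scale1r subrr.
  exact: noncentral_null0.
- exact: represents0.
- by rewrite -[X in X + _]scale1r -[X in represents _ (X + _)]scale1r; apply: represents_lin.
- rewrite -[X in represents X]addr0 -[X in represents _ X]addr0.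
  exact: represents_lin represents0.
- exact: represents_vdash.
- exact: represents_dashv.
Qed.

Lemma holds_in_square f : holds_in f (square T) -> holds_in f A.
Proof.
move=> fT v; have [_ _] := represents_eval v f.
rewrite fT => /(congr1 (fun x => coefs x 0)).
by rewrite coefs_pure coef1 scale1r => <-.
Qed.

End Reconstruction.

(** * Generated varieties and the two inclusions *)

Lemma generated_variety_is_variety (k : fieldType) (I : Type) (C : alg_class k I) :
  is_variety (generated_variety C).
Proof.
(* The defining identities are those common to all of [C]; conversely, each single identity defines
   a variety. *)
exists (fun f => subclass C (holds_in f)) => A; split=> [CA f Cf|CA V [E VE] CV].
  by apply: (CA (holds_in f)) => //; exists (eq f) => B; split=> [? ? <-|]; last exact.
by apply/VE => f Ef; apply: CA => B /CV /VE; apply.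
Qed.

Lemma holds_in_generated (k : fieldType) (I : Type) (C : alg_class k I) f :
  subclass C (holds_in f) -> subclass (generated_variety C) (holds_in f).
Proof.
by move=> Cf A; apply => //; exists (eq f) => B; split=> [? ? <-|]; last exact.
Qed.

Lemma sub_generated_variety (k : fieldType) (I : Type) (C : alg_class k I) :
  subclass C (generated_variety C).
Proof. by move=> A CA V _; apply. Qed.

Theorem corollary2 (k : fieldType) (Omega : Type)
    (char0 : [pchar k]%R =i pred0)
    (V : alg_class k (di_op Omega))
    (V_variety : is_variety V)
    (V_sub : subclass V (@diAlg0 k Omega)) :
  [/\ is_variety (hat V),
      subclass V (di (hat V)) &
      forall M : alg_class k Omega,
        is_variety M -> subclass V (di M) -> subclass (hat V) M].
Proof.
split; first exact: generated_variety_is_variety.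
  (* An identity of [W] is pulled back to [A] from one generator of [di (hat V)], the square of
     [zinb_box A]. *)
  move=> A VA W [E WE] CW; apply/WE => f Ef.
  apply: (holds_in_square char0 (V_sub _ VA)).
  apply: (proj1 (WE _) (CW _ _) f Ef).
  exists (perm2 k), (zinb_box A); split; [exact: perm2_Perm | | exact: square_perm_tensor].
  apply: sub_generated_variety; exists (zinb k), A.
  by split; [exact: zinb_preCom | | exact: zinb_box_tensor].
(* It suffices to test identities of [M] on box products; [central f] passes from perm tensors over
   [M] to [V], and [f] from there to the box product. *)
move=> M [E ME] V_di B; apply; first by exists E.
move=> {}B [Z [A [Z_preCom VA boxB]]]; apply/ME => f Ef.
apply: (holds_in_box char0 Z_preCom (V_sub _ VA) boxB).
apply: holds_in_generated (V_di _ VA) => D [P [C [P_perm MC tensorD]]].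
by apply: (holds_in_central_perm char0 P_perm tensorD); apply: (proj1 (ME _) MC).
Qed.
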